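(* Let $H$ be a matching covered hypergraph, let $\delta_H(S)$ be a tight cut of $H$, and let $x\in\mathbb{Q}^{E(H)}$. Then $x\in P(H)$ if and only if there exist $x^S\in P(H_S)$ and $x^{\overline S}\in P(H_{\overline S})$ that agree on $\delta_H(S)$ and satisfy $x=x^S\oplus x^{\overline S}$.
   Context: A hypergraph $H$ has a finite vertex set $V(H)$ and a finite family $E(H)$ of non-empty subsets of $V(H)$, called edges; parallel edges (distinct members with the same vertices) are allowed. A perfect matching of $H$ is a set $M$ of edges such that every vertex lies in exactly one edge of $M$. $H$ is matching covered if it is connected, $|E(H)|\geq 1$, and every edge lies in a perfect matching. For $S\subseteq V(H)$ put $\overline{S}=V(H)\setminus S$, and let $\delta_H(S)$ be the family of edges meeting both $S$ and $\overline S$. The cut $\delta_H(S)$ is tight if $|M\cap\delta_H(S)|=1$ for every perfect matching $M$ of $H$. The perfect matching polytope $P(H)\subseteq\mathbb{Q}^{E(H)}$ is the convex hull of the incidence vectors $\chi^M\in\{0,1\}^{E(H)}$ of the perfect matchings $M$ of $H$. Tight cut contractions: let $s,\overline s\notin V(H)$ be new vertices. For $e\in\delta_H(S)$ put $e_s=(e\setminus S)\cup\{s\}$ and $e_{\overline s}=(e\cap S)\cup\{\overline s\}$. Then $H_S$ has vertex set $\{s\}\cup\overline S$ and edges $\{e\in E(H): e\subseteq\overline S\}\cup\{e_s:e\in\delta_H(S)\}$, and $H_{\overline S}$ has vertex set $\{\overline s\}\cup S$ and edges $\{e\in E(H):e\subseteq S\}\cup\{e_{\overline s}:e\in\delta_H(S)\}$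 (each $e\in\delta_H(S)$ gives its own edge, so parallel edges may arise). Vectors $x^S\in\mathbb{Q}^{E(H_S)}$ and $x^{\overline S}\in\mathbb{Q}^{E(H_{\overline S})}$ agree on $\delta_H(S)$ if $x^S(e_s)=x^{\overline S}(e_{\overline s})$ for all $e\in\delta_H(S)$. In this case $x^S\oplus x^{\overline S}\in\mathbb{Q}^{E(H)}$ is the vector with value $x^S(e)$ at edges $e\subseteq\overline S$, value $x^{\overline S}(e)$ at edges $e\subseteq S$, and value $x^S(e_s)$ at edges $e\in\delta_H(S)$. *)

(* Defs.v *)
From HB Require Import structures.
From mathcomp Require Import all_boot all_order all_algebra.

Set Implicit Arguments.
Unset Strict Implicit.
Unset Printing Implicit Defensive.

Import GRing.Theory Num.Theory.
Local Open Scope ring_scope.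

(* Edges are abstract labels, each with a nonempty vertex set; distinct labels
   may have the same vertex set (parallel edges). *)
Record hypergraph := Hypergraph {
  vertex : finType;
  edge : finType;
  ends : edge -> {set vertex};
  ends_neq0 : forall e, ends e != set0
}.

Definition perfect_matching (H : hypergraph) (M : {set edge H}) : bool :=
  [forall v : vertex H, #|[set e in M | v \in ends e]| == 1%N].

Definition adjacent (H : hypergraph) : rel (vertex H) :=
  fun u v => [exists e : edge H, (u \in ends e) && (v \in ends e)].

Definition connected (H : hypergraph) : Prop :=
  forall u v : vertex H, connect (@adjacent H) u v.

Definition matching_covered (H : hypergraph) : Prop :=
  [/\ connected H,
      (0 < #|edge H|)%N
    & forall e : edge H, exists2 M : {set edge H}, perfect_matching M & e \in M].

Definition cut (H : hypergraph) (S : {set vertex H}) : {set edge H} :=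
  [set e | (ends e :&: S != set0) && (ends e :&: ~: S != set0)].

Definition tight (H : hypergraph) (S : {set vertex H}) : Prop :=
  forall M : {set edge H}, perfect_matching M -> #|M :&: cut S| = 1%N.

Definition convex_hull (V : lmodType rat) (A : V -> Prop) (x : V) : Prop :=
  exists (n : nat) (p : 'I_n -> V) (c : 'I_n -> rat),
    [/\ forall i, A (p i),
        forall i, 0 <= c i,
        \sum_(i < n) c i = 1
      & x = \sum_(i < n) c i *: p i].

(* [rat^o] is rat as a vector space over itself, which makes the function type
   an lmodType over rat. *)
Notation edge_vector H := {ffun edge H -> rat^o}.

Definition incidence_vector (H : hypergraph) (M : {set edge H}) :
  edge_vector H := [ffun e => (e \in M)%:R].

Definition pm_polytope (H : hypergraph) : edge_vector H -> Prop :=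
  convex_hull (fun y : edge_vector H =>
    exists2 M : {set edge H}, perfect_matching M & y = incidence_vector M).

Section Contraction.
Variables (H : hypergraph) (S : {set vertex H}).

(* [None] is the new vertex s; [Some v] is the vertex v outside S. *)
Definition contract_vertex : finType := option {v : vertex H | v \notin S}.

(* An edge of H_S is labelled by the edge of H it comes from: e itself if e is
   disjoint from S, and the label e stands for e_s if e lies in the cut. *)
Definition contract_edges : {set edge H} :=
  [set e | ends e \subset ~: S] :|: cut S.

Definition contract_edge : finType := {e : edge H | e \in contract_edges}.

Definition contract_ends (e : contract_edge) : {set contract_vertex} :=
  let outside : {set contract_vertex} :=
    [set Some v | v : {v : vertex H | v \notin S} & val v \in ends (val e)] in
  if val e \in cut S then None |: outside else outside.

Lemma contract_ends_neq0 (e : contract_edge) : contract_ends e != set0.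
Proof.
rewrite /contract_ends; case: ifPn => [_|ncut].
  by apply/set0Pn; exists None; rewrite setU11.
have sub : ends (val e) \subset ~: S.
  by have := valP e; rewrite !inE -/(cut S) => /orP[//|cute];
    rewrite inE cute in ncut.
have /set0Pn[v ve] := ends_neq0 (val e).
have vS : v \notin S by have := subsetP sub v ve; rewrite inE.
apply/set0Pn; exists (Some (exist _ v vS)).
by apply/imsetP; exists (exist _ v vS); rewrite ?inE.
Qed.

Definition contract : hypergraph := Hypergraph contract_ends_neq0.

(* The value of y at the edge of H_S coming from e. The default 0 is only
   reached when e is contained in S, where H_S has no corresponding edge. *)
Definition value_at (y : edge_vector contract) (e : edge H) : rat :=
  if (insub e : option contract_edge) is Some e' then y e' else 0.

Lemma value_atE (y : edge_vector contract) (e : contract_edge) :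
  value_at y (val e) = y e.
Proof. by rewrite /value_at valK. Qed.

End Contraction.

(* Since S is the complement of ~: S, the other contraction, of S-bar to a
   single vertex, is [contract (~: S)]. *)
Definition agree (H : hypergraph) (S : {set vertex H})
    (y : edge_vector (contract S))
    (z : edge_vector (contract (~: S))) : Prop :=
  forall e : edge H, e \in cut S -> value_at y e = value_at z e.

Definition glue (H : hypergraph) (S : {set vertex H})
    (y : edge_vector (contract S))
    (z : edge_vector (contract (~: S))) : edge_vector H :=
  [ffun e => if ends e \subset S then value_at z e else value_at y e].

(* Main.v *)
Require Import Defs.
From mathcomp Require Import all_boot all_order all_algebra.

(** Perfect matchings of [contract S] are the edge sets of [H] that cover each
    vertex outside [S] exactly once and contain exactly one edge of the cut.
    Restricting the matchings of a convex combination to both sides gives one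
    direction. Conversely, given convex combinations on the two sides, agreement
    on the cut says that the weights, pushed forward to the cut edges used by
    the matchings, coincide; two such weights admit a coupling supported on the
    pairs of matchings with the same cut edge, and every such pair glues to a
    perfect matching of [H]. *)

Set Implicit Arguments.
Unset Strict Implicit.
Unset Printing Implicit Defensive.

Import Order.TTheory GRing.Theory Num.Theory.
Local Open Scope ring_scope.

(** Over each [e], the product of the two weights, divided by their common mass on the fibre, has
    the required marginals. *)
Lemma coupling (R : realFieldType) (I J E : finType) (f : I -> E) (g : J -> E)
    (c : I -> R) (d : J -> R) :
  (forall i, 0 <= c i) -> (forall j, 0 <= d j) ->
  (forall e, \sum_(i | f i == e) c i = \sum_(j | g j == e) d j) ->
  exists w : I -> J -> R,
    [/\ forall i j, 0 <= w i j,
        forall i j, f i != g j -> w i j = 0,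
        forall i, \sum_j w i j = c i
      & forall j, \sum_i w i j = d j].
Proof.
move=> c0 d0 fg; pose a e := \sum_(i | f i == e) c i.
have a0 e : 0 <= a e by apply: sumr_ge0.
have ac i : a (f i) = 0 -> c i = 0.
  by move/psumr_eq0P=> /(_ (fun k _ => c0 k) i); apply.
have ad j : a (g j) = 0 -> d j = 0.
  by rewrite /a fg => /psumr_eq0P => /(_ (fun k _ => d0 k) j); apply.
(* If [a (f i) = 0], the quotient is [0], which is right since then [c i = 0]. *)
exists (fun i j => if f i == g j then c i * d j / a (f i) else 0); split.
- by move=> i j; case: eqP => // _; rewrite divr_ge0 ?mulr_ge0.
- by move=> i j /negPf->.
- move=> i; rewrite -big_mkcond /=.
  under eq_bigr do rewrite -mulrA mulrCA mulrC.
  under eq_bigl do rewrite eq_sym.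
  under eq_bigr do rewrite mulrC.
  (* By [fg] the sum of [d] over the fibre is [a (f i)], which cancels the denominator. *)
  rewrite -mulr_suml -fg -/(a _).
  have [/[dup] /ac-> -> |nz] := eqVneq (a (f i)) 0; first by rewrite mul0r.
  by rewrite mulrCA divff ?mulr1.
move=> j; rewrite -big_mkcond /=.
under eq_bigr => i /eqP-> do rewrite -mulrA.
rewrite -mulr_suml -/(a _).
have [/[dup] /ad-> -> |nz] := eqVneq (a (g j)) 0; first by rewrite !mul0r.
by rewrite mulrCA divff ?mulr1.
Qed.

Lemma convex_hull_fin (V : lmodType rat) (A : V -> Prop) (T : finType)
    (P : {pred T}) (p : T -> V) (c : T -> rat) :
  (forall t, t \in P -> A (p t)) -> (forall t, 0 <= c t) ->
  \sum_(t in P) c t = 1 -> convex_hull A (\sum_(t in P) c t *: p t).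
Proof.
move=> Ap c0 c1; exists #|P|, (fun i => p (enum_val i)),
  (fun i => c (enum_val i)); split=> //.
- by move=> i; apply/Ap/enum_valP.
- by rewrite -(big_enum_val (A := P) c).
- by rewrite -(big_enum_val (A := P) (fun t => c t *: p t)).
Qed.

Lemma sum_incidenceE (H : hypergraph) (I : finType) (P : pred I) (c : I -> rat)
    (M : I -> {set edge H}) (e : edge H) :
  (\sum_(i | P i) c i *: incidence_vector (M i)) e =
  \sum_(i | P i) c i * (e \in M i)%:R.
Proof. by rewrite sum_ffunE; apply: eq_bigr => i _; rewrite !ffunE. Qed.

Section Contraction.
Variables (H : hypergraph) (S : {set vertex H}).

Lemma cutC : cut (~: S) = cut S.
Proof. by apply/setP=> e; rewrite !inE setCK andbC. Qed.

(** Edges are non-empty, so none is both inside [S] and disjoint from [S]. *)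
Lemma contract_edgesE (e : edge H) :
  (e \in contract_edges S) = ~~ (ends e \subset S).
Proof.
rewrite !inE -!setDE setD_eq0 -[in X in X || _](setCK S) -disjoints_subset.
rewrite setCK -setI_eq0; case: eqVneq => //= eS0.
by apply/esym/negP => /setIidPl eS; have := ends_neq0 e; rewrite -eS eS0 eqxx.
Qed.

Lemma cut_contract_edges (e : edge H) : e \in cut S -> e \in contract_edges S.
Proof. by move=> eS; rewrite inE eS orbT. Qed.

Lemma mem_contract_endsE (e : edge (contract S)) (u : vertex (contract S)) :
  (u \in ends e) =
  if u is Some v then val v \in ends (val e) else val e \in cut S.
Proof.
have outE : (u \in [set Some w | w : {w | w \notin S} & val w \in ends (val e)])
    = if u is Some v then val v \in ends (val e) else false.
  apply/imsetP/idP => [[w + ->]|]; first by rewrite inE.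
  by case: u => // v ve; exists v; rewrite ?inE.
rewrite [ends e]/(contract_ends e) /contract_ends; case: ifPn => ecut.
  by rewrite in_setU1 outE; case: u {outE}.
by rewrite outE; case: u {outE} => //=; apply/esym/negPf.
Qed.

(** The new vertex [None] lies exactly in the cut edges, so its degree condition is the cut
    condition. Edges of [L] inside [S] affect neither side. *)
Lemma perfect_matching_contractP (L : {set edge H}) :
  reflect ((forall v, v \notin S -> #|[set e in L | v \in ends e]| = 1%N) /\
           #|L :&: cut S| = 1%N)
    (@perfect_matching (contract S) [set e | val e \in L]).
Proof.
have cardE (u : vertex (contract S)) :
    #|[set e in [set e : edge (contract S) | val e \in L] | u \in ends e]| =
    if u is Some v then #|[set e in L | val v \in ends e]| else #|L :&: cut S|.
  rewrite -(card_imset _ val_inj).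
  case: u => [v|]; congr #|pred_of_set _|; apply/setP => e.
    apply/imsetP/idP => [[e' + ->]|]; first by rewrite !inE mem_contract_endsE.
    rewrite inE => /andP[eL ve].
    have eC : e \in contract_edges S.
      rewrite contract_edgesE; apply/subsetPn.
      by exists (val v) => //; apply: (valP v).
    by exists (Sub e eC); rewrite // !inE mem_contract_endsE /= eL ve.
  apply/imsetP/idP => [[e' + ->]|].
    by rewrite inE [X in X && _]inE mem_contract_endsE in_setI.
  rewrite inE => /andP[eL ecut].
  exists (Sub e (cut_contract_edges ecut)) => //.
  by rewrite inE [X in X && _]inE mem_contract_endsE /= eL ecut.
apply: (iffP forallP) => [pmL|[pmL cutL] u].
  split=> [v vS|]; last by have := pmL None; rewrite cardE => /eqP.
  by have := pmL (Some (Sub v vS)); rewrite cardE => /eqP.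
by rewrite cardE; case: u => [v|]; rewrite ?cutL // pmL // (valP v).
Qed.

Lemma value_at_sum (I : finType) (c : I -> rat)
    (N : I -> {set edge (contract S)}) (e : edge H) :
  value_at (\sum_i c i *: incidence_vector (N i)) e =
  \sum_i c i * (e \in val @: N i)%:R.
Proof.
rewrite /value_at; case: insubP => [e' _ <-|eC].
  rewrite sum_incidenceE; apply: eq_bigr => i _.
  by rewrite mem_imset //; apply: val_inj.
(* Here [value_at] takes its default 0, and indeed [e] is the label of no edge of the
   contraction. *)
rewrite big1 // => i _; case: imsetP => [[e' _ ee']|]; last by rewrite mulr0.
by rewrite ee' (valP e') in eC.
Qed.

(** Moves the matchings into [edge H], where those of the two contractions can be compared, and
    names the cut edge [f i] of each. *)
Lemma pm_polytope_contract (y : edge_vector (contract S)) :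
  pm_polytope y ->
  exists (n : nat) (L : 'I_n -> {set edge H}) (f : 'I_n -> edge H)
         (c : 'I_n -> rat),
    [/\ forall i v, v \notin S -> #|[set e in L i | v \in ends e]| = 1%N,
        forall i, L i :&: cut S = [set f i],
        forall i, 0 <= c i,
        \sum_i c i = 1
      & forall e, value_at y e = \sum_i c i * (e \in L i)%:R].
Proof.
case=> n [p [c [/fin_all_exists2[N pmN pE] c0 c1 ->]]].
have pmL i : (forall v, v \notin S ->
      #|[set e in val @: N i | v \in ends e]| = 1%N) /\
    #|(val @: N i) :&: cut S| = 1%N.
  apply/perfect_matching_contractP; congr perfect_matching: (pmN i).
  by apply/setP => e; rewrite inE mem_imset //; apply: val_inj.
have /fin_all_exists[f fE] i : exists e, (val @: N i) :&: cut S = [set e].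
  by apply/cards1P; case: (pmL i) => _ ->.
exists n, (fun i => val @: N i), f, c; split=> //.
  by move=> i; case: (pmL i).
by move=> e; under eq_bigr do rewrite pE; rewrite value_at_sum.
Qed.

(** Tightness is what makes each restricted matching cover the new vertex exactly once. *)
Lemma pm_polytope_restrict (n : nat) (M : 'I_n -> {set edge H})
    (c : 'I_n -> rat) :
  tight S -> (forall i, perfect_matching (M i)) ->
  (forall i, 0 <= c i) -> \sum_i c i = 1 ->
  pm_polytope (\sum_i c i *:
    @incidence_vector (contract S) [set e | val e \in M i]).
Proof.
move=> tS pmM c0 c1; exists n, (fun i =>
  @incidence_vector (contract S) [set e | val e \in M i]), c; split=> // i.
exists [set e | val e \in M i] => //; apply/perfect_matching_contractP.
by split=> [v _|]; [apply/eqP/(forallP (pmM i)) | apply/tS/pmM].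
Qed.

Lemma value_at_restrict (n : nat) (M : 'I_n -> {set edge H})
    (c : 'I_n -> rat) (e : edge H) :
  ~~ (ends e \subset S) ->
  value_at (\sum_i c i *:
    @incidence_vector (contract S) [set e | val e \in M i]) e =
  (\sum_i c i *: incidence_vector (M i)) e.
Proof.
rewrite -contract_edgesE => eC.
rewrite (value_atE _ (Sub e eC)) !sum_incidenceE.
by apply: eq_bigr => i _; rewrite inE.
Qed.

(** At a vertex outside [S] only [L] is consulted. At a vertex of [S], an edge not inside [S]
    crosses the cut, where [L] and [L'] coincide. *)
Lemma perfect_matching_glue (L L' : {set edge H}) (f : edge H) :
  (forall v, v \notin S -> #|[set e in L | v \in ends e]| = 1%N) ->
  (forall v, v \in S -> #|[set e in L' | v \in ends e]| = 1%N) ->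
  L :&: cut S = [set f] -> L' :&: cut S = [set f] ->
  perfect_matching [set e | e \in if ends e \subset S then L' else L].
Proof.
move=> pmL pmL' Lf L'f; apply/forallP => v; apply/eqP.
have [vS|vS] := boolP (v \in S); [rewrite -(pmL' v vS)|rewrite -(pmL v vS)];
  congr #|pred_of_set _|; apply/setP => e; rewrite !inE.
all: case: ifPn => // eS; case ve: (v \in ends e); rewrite ?andbF ?andbT //.
  have ecut : e \in cut S.
    rewrite inE -setDE setD_eq0 eS andbT.
    by apply/set0Pn; exists v; rewrite inE ve.
  move/setP/(_ e): Lf; rewrite -L'f in_setI ecut andbT.
  by rewrite in_setI ecut andbT.
by rewrite (subsetP eS) in vS.
Qed.

End Contraction.

Theorem proposition3p5 (H : hypergraph) (S : {set vertex H})
    (x : edge_vector H) :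
  matching_covered H ->
  tight S ->
  (pm_polytope x <->
   exists (xS : edge_vector (contract S))
          (xSbar : edge_vector (contract (~: S))),
     [/\ pm_polytope xS, pm_polytope xSbar, agree xS xSbar
       & x = glue xS xSbar]).
Proof.
move=> _ tS; split.
  case=> n [p [c [/fin_all_exists2[M pmM pE] c0 c1 ->]]].
  have tSC : tight (~: S) by move=> N /tS; rewrite cutC.
  have valC e : ~~ (ends e \subset ~: S) ->
      value_at (\sum_i c i *:
        @incidence_vector (contract (~: S)) [set e | val e \in M i]) e =
      (\sum_i c i *: incidence_vector (M i)) e by apply: value_at_restrict.
  do 2!eexists; split; [exact: (pm_polytope_restrict tS pmM c0 c1)
    |exact: (pm_polytope_restrict tSC pmM c0 c1)| |].
    move=> e; rewrite inE -setDE setD_eq0 => /andP[eS eSC].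
    rewrite value_at_restrict // valC // -disjoints_subset -setI_eq0 //.
  apply/ffunP => e; under eq_bigr do rewrite pE.
  rewrite [RHS]ffunE; case: ifPn => eS; last by rewrite value_at_restrict.
  rewrite valC // -disjoints_subset -setI_eq0.
  by move/setIidPl: eS => ->; apply: ends_neq0.
case=> y [z [/pm_polytope_contract[n [L [f [c [pmL Lf c0 c1 yE]]]]]]].
case/pm_polytope_contract=> m [L' [g [d [pmL' Lg d0 d1 zE]]]] agr ->.
rewrite cutC in Lg.
have memL e i : e \in cut S -> (e \in L i) = (f i == e).
  by move=> eS; move/setP/(_ e): (Lf i); rewrite in_setI eS andbT inE eq_sym.
have memL' e j : e \in cut S -> (e \in L' j) = (g j == e).
  by move=> eS; move/setP/(_ e): (Lg j); rewrite in_setI eS andbT inE eq_sym.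
have fcut i : f i \in cut S.
  by have := set11 (f i); rewrite -Lf inE => /andP[].
have gcut j : g j \in cut S.
  by have := set11 (g j); rewrite -Lg inE => /andP[].
have [e|w [w0 wfg wc wd]] := coupling c0 d0 (f := f) (g := g).
  (* Off the cut both fibres are empty; on it, the fibre masses are the values of [y] and [z] at
     [e], equal by agreement. *)
  have [eS|eS] := boolP (e \in cut S); last first.
    by rewrite !big_pred0 // => i; apply: contraNF eS => /eqP<-.
  have := agr e eS; rewrite yE zE => yz.
  rewrite big_mkcond [RHS]big_mkcond.
  under eq_bigr do rewrite -memL // -mulrb -mulr_natr.
  by under [RHS]eq_bigr do rewrite -memL' // -mulrb -mulr_natr.
pose P := [pred t : 'I_n * 'I_m | f t.1 == g t.2].
pose M (t : 'I_n * 'I_m) :=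
  [set e | e \in if ends e \subset S then L' t.2 else L t.1].
(* Since [w] vanishes outside [P], sums over [P] become full double sums, to which the marginals
   [wc] and [wd] apply. *)
have sumP (F : 'I_n * 'I_m -> rat) :
    \sum_(t in P) w t.1 t.2 * F t = \sum_i \sum_j w i j * F (i, j).
  rewrite pair_big /= [RHS](bigID P) /= [X in _ + X]big1 ?addr0 => [|t /wfg ->].
    by apply: eq_bigr => -[].
  by rewrite mul0r.
have -> : glue y z = \sum_(t in P) w t.1 t.2 *: incidence_vector (M t).
  apply/ffunP => e; rewrite sum_incidenceE sumP ffunE.
  (* Inside [S] membership in [M (i, j)] depends on [j] only, so summing over [i] first leaves
     [d j]; elsewhere it depends on [i] only. *)
  case: ifP => eS; rewrite ?yE ?zE.
    rewrite exchange_big; apply: eq_bigr => j _ /=.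
    by rewrite -wd mulr_suml; apply: eq_bigr => i _; rewrite inE eS.
  apply: eq_bigr => i _.
  by rewrite -wc mulr_suml; apply: eq_bigr => j _; rewrite inE eS.
apply: convex_hull_fin => [t /eqP fg|t|]; last 2 first.
- exact: w0.
- under eq_bigr do rewrite -[w _ _]mulr1.
  rewrite (sumP (fun=> 1)) -[RHS]c1; apply: eq_bigr => i _.
  by rewrite -wc; apply: eq_bigr => j _; rewrite mulr1.
exists (M t) => //.
apply: (perfect_matching_glue (pmL t.1) _ (Lf t.1)); last by rewrite fg Lg.
by move=> v vS; apply: pmL'; rewrite inE vS.
Qed.
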